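(* Let $A\subseteq B$ be a non-degenerate C*-subalgebra of a C*-algebra $B$. Let $$\mathcal{S}(A)=\{M\subseteq N(A): M\text{ is a closed linear space and }AM\subseteq M,\ MA\subseteq M\}$$ and define $M\cdot N=\overline{\mathrm{span}}\{mn:m\in M,n\in N\}$ and $M^*=\{m^*:m\in M\}$ for $M,N\in\mathcal{S}(A)$. These operations turn $\mathcal{S}(A)$ into an inverse semigroup with unit $A\in\mathcal{S}(A)$. And $(M)_{M\in\mathcal{S}(A)}$ is a saturated $\mathcal{S}(A)$-grading on the C*-algebra $\overline{\sum_{M\in\mathcal{S}(A)}M}$. The C*-inclusion $A\subseteq B$ is regular if and only if $B=\overline{\sum_{M\in\mathcal{S}(A)}M}$.
   Context: $A\subseteq B$ is non-degenerate if $AB=B$ (closed linear span). An element $b\in B$ normalises $A$ if $bAb^*\subseteq A$ and $b^*Ab\subseteq A$; $N(A)\subseteq B$ is the set of such elements. The inclusion $A\subseteq B$ is regular if it is non-degenerate and $N(A)$ generates $B$ as a C*-algebra. For an inverse semigroup $S$ with unit $e$, an $S$-grading on a C*-algebra $D$ is a family of closed linear subspaces $(D_t)_{t\in S}$ with $D_g^*=D_{g^*}$, $D_gD_h\subseteq D_{gh}$ for all $g,h\in S$, $D_g\subseteq D_h$ if $g\le h$ in the natural partial order of $S$, and $\sum_tD_t$ dense in $D$. It is saturated if $D_g\cdot D_h=D_{gh}$ (closed linear span) for all $g,h\in S$. *)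

(* Defs.v *)
From HB Require Import structures.
From mathcomp Require Import all_boot all_order all_algebra.
From mathcomp Require Export complex.
From mathcomp Require Export all_classical all_reals topology normedtype.
Set Implicit Arguments.
Unset Strict Implicit.
Unset Printing Implicit Defensive.
Import Order.TTheory GRing.Theory Num.Theory.
Import numFieldNormedType.Exports.
Local Open Scope classical_set_scope.
Local Open Scope ring_scope.

Declare Scope cstar_scope.
Delimit Scope cstar_scope with cstar.

(* No unit is assumed, so MathComp's ring structures cannot provide the
   product.  The norm takes its values in R[i]; norms are real and nonnegative
   there, and <= on R[i] restricts to the usual order on real elements. *)
HB.mixin Record CompleteNormedModule_isCStarAlgebra (R : realType) B
    of CompleteNormedModule R[i] B := {
  cmul : B -> B -> B;
  star : B -> B;
  cmulA : forall a b c, cmul a (cmul b c) = cmul (cmul a b) c;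
  cmulDl : forall a b c, cmul (a + b) c = cmul a c + cmul b c;
  cmulDr : forall a b c, cmul a (b + c) = cmul a b + cmul a c;
  cmulZl : forall (k : R[i]) a b, cmul (k *: a) b = k *: cmul a b;
  cmulZr : forall (k : R[i]) a b, cmul a (k *: b) = k *: cmul a b;
  starK : forall a, star (star a) = a;
  starD : forall a b, star (a + b) = star a + star b;
  starZ : forall (k : R[i]) a, star (k *: a) = Num.conj k *: star a;
  starM : forall a b, star (cmul a b) = cmul (star b) (star a);
  ler_norm_cmul : forall a b, `|cmul a b| <= `|a| * `|b|;
  norm_cstar : forall a, `|cmul (star a) a| = `|a| ^+ 2
}.

#[short(type="cstarAlgType")]
HB.structure Definition CStarAlgebra (R : realType) :=
  {B of CompleteNormedModule_isCStarAlgebra R B & CompleteNormedModule R[i] B}.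

Notation "a ** b" := (cmul a b) (at level 40, left associativity) : cstar_scope.
Local Open Scope cstar_scope.

Section CStarSubsets.
Context {R : realType} {B : cstarAlgType R}.
Implicit Types A D M X Y : set B.

Definition linear_subspace M : Prop :=
  M 0 /\ forall (k : R[i]) x y, M x -> M y -> M (k *: x + y).

Definition closed_linear_subspace M : Prop :=
  linear_subspace M /\ closed M.

Definition lspan X : set B :=
  [set x | exists (n : nat) (k : 'I_n -> R[i]) (v : 'I_n -> B),
     (forall i, X (v i)) /\ x = \sum_(i < n) k i *: v i].

Definition closed_span X : set B := closure (lspan X).

Definition prod_closed_span X Y : set B :=
  closed_span [set x ** y | x in X & y in Y].

Definition star_set X : set B := [set star x | x in X].

(* The closure of the algebraic sum of the D t; for a family of linear
   subspaces that sum is the linear span of their union. *)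
Definition closed_sum {T : Type} (S : set T) (F : T -> set B) : set B :=
  closed_span (\bigcup_(t in S) F t).

Definition cstar_subalgebra A : Prop :=
  [/\ closed_linear_subspace A,
      (forall x y, A x -> A y -> A (x ** y))
    & (forall x, A x -> A (star x))].

Definition generated_cstar_subalgebra X : set B :=
  smallest cstar_subalgebra X.

Definition nondegenerate_incl A : Prop := prod_closed_span A setT = setT.

Definition normalises (b : B) A : Prop :=
  (forall a, A a -> A (b ** a ** star b)) /\
  (forall a, A a -> A (star b ** a ** b)).

Definition normalisers A : set B := [set b | normalises b A].

Definition regular_incl A : Prop :=
  nondegenerate_incl A /\ generated_cstar_subalgebra (normalisers A) = setT.

Definition slices A : set (set B) :=
  [set M | [/\ M `<=` normalisers A,
               closed_linear_subspace M,
               (forall a m, A a -> M m -> M (a ** m))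
             & (forall a m, A a -> M m -> M (m ** a))]].

End CStarSubsets.

(* The semigroup lives on the subset S of T: the axioms only concern elements
   of S, and op and inv are required to preserve S.  An inverse semigroup has a
   unique generalised inverse for each element; inv names it. *)
Record inverse_semigroup {T : Type} (S : set T)
    (op : T -> T -> T) (inv : T -> T) : Prop := InverseSemigroup {
  isg_op : forall s t, S s -> S t -> S (op s t);
  isg_inv : forall s, S s -> S (inv s);
  isg_opA : forall s t u, S s -> S t -> S u ->
    op s (op t u) = op (op s t) u;
  isg_opVK : forall s, S s -> op (op s (inv s)) s = s;
  isg_opKV : forall s, S s -> op (op (inv s) s) (inv s) = inv s;
  isg_inv_unique : forall s t, S s -> S t ->
    op (op s t) s = s -> op (op t s) t = t -> t = inv s
}.

Definition semigroup_unit {T : Type} (S : set T)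
    (op : T -> T -> T) (e : T) : Prop :=
  S e /\ forall s, S s -> op e s = s /\ op s e = s.

Definition natural_le {T : Type} (S : set T)
    (op : T -> T -> T) (g h : T) : Prop :=
  exists e, [/\ S e, op e e = e & g = op h e].

(* Gradings of a C*-algebra D presented as a C*-subalgebra of B; as D is closed
   in B, closures in D and in B coincide. *)
Record grading {R : realType} {B : cstarAlgType R} {T : Type} (S : set T)
    (op : T -> T -> T) (inv : T -> T) (F : T -> set B) (D : set B) : Prop :=
  Grading {
  grading_subspace : forall t, S t -> closed_linear_subspace (F t);
  grading_sub : forall t, S t -> F t `<=` D;
  grading_star : forall g, S g -> star_set (F g) = F (inv g);
  grading_op : forall g h x y, S g -> S h -> F g x -> F h y ->
    F (op g h) (x ** y);
  grading_le : forall g h, S g -> S h -> natural_le S op g h -> F g `<=` F h;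
  grading_dense : closed_sum S F = D
}.

Definition saturated {R : realType} {B : cstarAlgType R} {T : Type}
    (S : set T) (op : T -> T -> T) (F : T -> set B) : Prop :=
  forall g h, S g -> S h -> prod_closed_span (F g) (F h) = F (op g h).

(* Main.v *)
Require Import Defs.
From mathcomp Require Import all_boot all_order all_algebra.
From mathcomp Require Import complex all_classical all_reals topology normedtype.
Import Order.TTheory GRing.Theory Num.Theory.
Import numFieldNormedType.Exports.
Local Open Scope classical_set_scope.
Local Open Scope ring_scope.
Local Open Scope cstar_scope.
Set Implicit Arguments.
Unset Strict Implicit.
Unset Printing Implicit Defensive.

(** As [B] need not have a unit, the symbol [1] below is formal.  The only
    analytic tool is a good supply of elements [u] of [A] for which
    [x |-> x - u ** x] is a contraction of [B].

    The source of such [u] is the resolvent of a self-adjoint [h] in [A]: for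
    [d > 0] the element [u = h (h + i d)^-1] solves [h u + i d u = h].  Since
    [1 - 2 u] is, up to sign, the Cayley transform of [h], it acts
    isometrically, so [1 - u = (1 + (1 - 2 u)) / 2] is a contraction; this
    bypasses positivity and the functional calculus.  The resolvent exists by Banach's fixed point
    argument for large [d], and the contraction property is what allows [d] to
    be halved any number of times.  For [h = a a*] one gets
    [`|(1 - u) a|^2 <= d], hence approximate units ([approx_unit]).

    Now let [M], [N] be slices.  Polarisation gives [M* A M] inside [A], and
    inserting an approximate unit gives [M* M] and [M M*] inside [A]; so the
    product of slices is a slice, and [A M = M = M A].  Moreover [M M* M = M],
    because the resolvent attached to [h = m m*] lies in the range of
    multiplication by [h]: [u m] belongs to [m m* M] and [u m] tends to [m].
    Slices contained in [A] are ideals, and they commute.  The decisive step is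
    that every idempotent slice [E] is contained in [A]
    ([idempotent_slice_subA]); idempotents therefore commute, and generalised
    inverses in a semigroup with commuting idempotents are unique.  It also
    shows that [M E] is contained in [M], as the grading requires.

    Finally a normaliser [b] lies in the slice spanned by [A b A], so the slices
    and the normalisers generate the same C*-subalgebra. *)

(** * Closed sets and fixed points in complete normed spaces *)

Section Analysis.
Variables (R : realType) (B : completeNormedModType R[i]).
Implicit Types (X M : set B) (x y : B) (c e : R[i]).

(** [R[i]] is only partially ordered, so the archimedean property is read off
    from the real parts. *)
Lemma geometric_half_lt c e : 0 <= c -> 0 < e -> exists n, c * 2^-1 ^+ n < e.
Proof.
move=> c0 e0.
have cE : c = (complex.Re c)%:C%C by rewrite RRe_real // ger0_real.
have eE : e = (complex.Re e)%:C%C by rewrite RRe_real // gtr0_real.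
set c' := complex.Re c in cE; set e' := complex.Re e in eE.
have e'0 : 0 < e' by rewrite -ltcR -eE.
have c'0 : 0 <= c' by rewrite -lecR -cE.
exists (Num.bound (c' / e')).
rewrite exprVn ltr_pdivrMr ?exprn_gt0 ?ltr0n // cE eE.
rewrite (_ : 2 = 2%:R%:C%C); last by rewrite rmorph_nat.
rewrite -rmorphXn -rmorphM ltcR mulrC -ltr_pdivrMr //.
apply: (lt_trans (archi_boundP _)); first by rewrite divr_ge0 // ltW.
by rewrite -natrX ltr_nat ltn_expl.
Qed.

Lemma closure_dist X x e :
  closure X x -> 0 < e -> exists2 y, X y & `|x - y| < e.
Proof.
move=> Xx e0; have [y [Xy /= yx]] := Xx _ (nbhsx_ballx x e e0).
by exists y => //; rewrite -ball_normE in yx.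
Qed.

Lemma dist_closure X x :
  (forall e, 0 < e -> exists2 y, X y & `|x - y| < e) -> closure X x.
Proof.
move=> H U /nbhs_ballP[e /= e0 eU].
have [y Xy yx] := H _ e0; exists y; split => //.
by apply: eU; rewrite -ball_normE.
Qed.

Lemma closed_dist M x : closed M ->
  (forall e, 0 < e -> exists2 y, M y & `|x - y| < e) -> M x.
Proof. by move=> /closure_id ME /dist_closure; rewrite -ME. Qed.

Lemma closed_preim_lipschitz (f : B -> B) c M : 0 <= c ->
  (forall x y, `|f x - f y| <= c * `|x - y|) -> closed M -> closed (f @^-1` M).
Proof.
move=> c0 fc cM x /= Mx; apply: closed_dist => // e e0.
have c1 : 0 < c + 1 by rewrite ltr_wpDl.
have [y My xy] := closure_dist Mx (divr_gt0 e0 c1).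
exists (f y) => //; apply: le_lt_trans (fc _ _) _.
apply: (@le_lt_trans _ _ ((c + 1) * `|x - y|)).
  by rewrite ler_wpM2r // lerDl.
by rewrite mulrC -ltr_pdivlMr.
Qed.

(** Banach's fixed point theorem, for scalars in [R[i]] rather than in a real
    field; the ratio 1/2 is the only one needed for resolvents. *)
Lemma half_lipschitz_fixpoint M (f : B -> B) : closed M -> M !=set0 ->
  (forall x, M x -> M (f x)) ->
  (forall x y, `|f x - f y| <= 2^-1 * `|x - y|) -> exists2 x, M x & f x = x.
Proof.
move=> cM [x0 Mx0] fM fc.
pose u n := iter n f x0; pose d := `|f x0 - x0|.
have h0 : (0 : R[i]) < 2^-1 by rewrite invr_gt0 ltr0n.
have u0 m : `|u m - x0| <= d * 2.
  elim: m => [|m IH]; first by rewrite subrr normr0 mulr_ge0 /d.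
  rewrite mulr_natr mulr2n -(subrKA (f x0)).
  rewrite (le_trans (ler_normD _ _)) // lerD //.
  by rewrite (le_trans (fc _ _)) // mulrC ler_pdivrMr ?ltr0n.
have um n m : `|u (n + m)%N - u n| <= d * 2 * 2^-1 ^+ n.
  elim: n => [|n IH]; first by rewrite expr0 mulr1.
  by rewrite addSn (le_trans (fc _ _)) // exprSr mulrA [leRHS]mulrC ler_pM2l.
have Cu : cauchy (u @ \oo).
  apply: cauchy_exP => e e0.
  have d2 : 0 <= d * 2 by rewrite mulr_ge0 /d.
  have [n nd] := geometric_half_lt d2 e0.
  exists (u n), n => // k /= nk; rewrite -ball_normE /= distrC -(subnKC nk).
  exact: le_lt_trans (um _ _) nd.
have [x ux] : exists x, u @ \oo --> x.
  by exists (lim (u @ \oo)); exact: (cauchy_cvg _ Cu).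
exists x.
  apply: closed_cvg ux => //; apply: nearW => n; elim: n => //= n; exact: fM.
apply/subr0_eq/normr0_eq0/eqP; rewrite eq_le normr_ge0 andbT.
apply/ler_addgt0Pr => e e0; rewrite add0r.
have /cvgrPdist_lt/(_ _ (divr_gt0 e0 (ltr0n _ 2)))[N _ HN] := ux.
have xN := HN _ (leqnn N); have xN1 := HN _ (leqnSn N).
rewrite -(subrKA (f (u N))) [e]splitr (le_trans (ler_normD _ _)) // lerD //.
  rewrite (le_trans (fc _ _)) // mulrC ler_pdivrMr ?ltr0n //.
  rewrite (le_trans (ltW xN)) //.
  by rewrite ler_peMr ?ler1n // divr_ge0 // ltW.
by rewrite distrC ltW.
Qed.

End Analysis.

(** * Closed spans and their products *)

Section Spans.
Variables (R : realType) (B : cstarAlgType R).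
Implicit Types (X Y Z M N A : set B) (a b x y : B) (k : R[i]).

Lemma mulBc x y z : (x - y) ** z = x ** z - y ** z.
Proof. by rewrite -scaleN1r cmulDl cmulZl scaleN1r. Qed.

Lemma mulcB x y z : x ** (y - z) = x ** y - x ** z.
Proof. by rewrite -scaleN1r cmulDr cmulZr scaleN1r. Qed.

Lemma mul0c x : 0 ** x = 0 :> B.
Proof. by rewrite -[X in X ** _](subrr x) mulBc subrr. Qed.

Lemma mulc0 x : x ** 0 = 0 :> B.
Proof. by rewrite -[X in _ ** X](subrr x) mulcB subrr. Qed.

Lemma starB x y : star (x - y) = star x - star y.
Proof. by rewrite -scaleN1r starD starZ rmorphN1 scaleN1r. Qed.

Lemma star0 : star 0 = 0 :> B.
Proof. by rewrite -[X in star X](subrr 0) starB subrr. Qed.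

Lemma norm_star x : `|star x| = `|x|.
Proof.
have le y : `|y| <= `|star y|.
  have [->|y0] := eqVneq y 0; first by rewrite normr0.
  by rewrite -(@ler_pM2r _ `|y|) ?normr_gt0 // -expr2 -norm_cstar ler_norm_cmul.
by apply/eqP; rewrite eq_le le -{2}(starK x) le.
Qed.

Lemma subspaceD M x y : linear_subspace M -> M x -> M y -> M (x + y).
Proof. by case=> _ H Mx My; rewrite -[x]scale1r; apply: H. Qed.

Lemma subspaceZ M k x : linear_subspace M -> M x -> M (k *: x).
Proof. by case=> M0 H Mx; rewrite -[_ *: _]addr0; apply: H. Qed.

Lemma subspaceB M x y : linear_subspace M -> M x -> M y -> M (x - y).
Proof.
by move=> sM Mx My; apply: subspaceD => //; rewrite -scaleN1r; apply: subspaceZ.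
Qed.

Lemma lspan_subspace X : linear_subspace (lspan X).
Proof.
split.
  exists 0, (fun=> 0), (fun=> 0); split; last by rewrite big_ord0.
  by case.
move=> k _ _ [n [kx [vx [Xx ->]]]] [m [ky [vy [Xy ->]]]].
exists (n + m)%N.
exists (fun i =>
  match fintype.split i with inl j => k * kx j | inr j => ky j end).
exists (fun i =>
  match fintype.split i with inl j => vx j | inr j => vy j end); split.
  by move=> i; case: (fintype.split i).
rewrite big_split_ord scaler_sumr; congr (_ + _); apply: eq_bigr => i _.
  by rewrite -[lshift _ _]/(fintype.unsplit (inl i)) unsplitK scalerA.
by rewrite -[rshift _ _]/(fintype.unsplit (inr i)) unsplitK.
Qed.

Lemma sub_lspan X : X `<=` lspan X.
Proof.
move=> x Xx; exists 1, (fun=> 1), (fun=> x); split => //.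
by rewrite big_ord1 scale1r.
Qed.

Lemma lspan_min X M : linear_subspace M -> X `<=` M -> lspan X `<=` M.
Proof.
move=> sM XM _ [n [k [v [Xv ->]]]].
apply: (big_ind M); first by case: sM.
- by move=> x y; exact: subspaceD.
- by move=> i _; apply: subspaceZ => //; apply: XM.
Qed.

Lemma closure_subspace M :
  linear_subspace M -> closed_linear_subspace (closure M).
Proof.
move=> sM; split; last exact: closed_closure.
split; first by apply: subset_closure; case: sM.
move=> k x y Mx My; apply: dist_closure => e e0.
have k1 : 0 < `|k| + 1 by rewrite ltr_wpDl.
have e2 : 0 < e / 2 by rewrite divr_gt0 ?ltr0n.
have [x' Mx' xx'] := closure_dist Mx (divr_gt0 e2 k1).
have [y' My' yy'] := closure_dist My e2.
exists (k *: x' + y'); first by case: sM => _; apply.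
rewrite opprD addrACA -scalerBr [e]splitr (le_lt_trans (ler_normD _ _)) //.
rewrite ltr_leD ?(ltW yy') // normrZ; move: xx'; rewrite ltr_pdivlMr //.
by apply: le_lt_trans; rewrite mulrC ler_wpM2l // lerDl.
Qed.

Lemma closed_span_subspace X : closed_linear_subspace (closed_span X).
Proof. exact/closure_subspace/lspan_subspace. Qed.

Lemma sub_closed_span X : X `<=` closed_span X.
Proof. by move=> x Xx; apply/subset_closure/sub_lspan. Qed.

(** The induction principle for closed spans.  Combined with the next three
    lemmas, it reduces membership of [x] in sets such as
    [[set x | M (star x ** a ** y)]] to the case of generators. *)
Lemma closed_span_min X M :
  closed_linear_subspace M -> X `<=` M -> closed_span X `<=` M.
Proof.
move=> [sM /closure_id ME] XM; rewrite ME; apply: closureS; exact: lspan_min.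
Qed.

Lemma preim_mulr_subspace a M :
  closed_linear_subspace M -> closed_linear_subspace [set x | M (x ** a)].
Proof.
move=> [[M0 sM] cM]; split.
  split=> [|k x y]; first by rewrite /= mul0c.
  by rewrite /= cmulDl cmulZl; apply: sM.
apply: (closed_preim_lipschitz (f := fun x => x ** a) (normr_ge0 a)) => // x y.
by rewrite -mulBc mulrC ler_norm_cmul.
Qed.

Lemma preim_mull_subspace a M :
  closed_linear_subspace M -> closed_linear_subspace [set x | M (a ** x)].
Proof.
move=> [[M0 sM] cM]; split.
  split=> [|k x y]; first by rewrite /= mulc0.
  by rewrite /= cmulDr cmulZr; apply: sM.
apply: (closed_preim_lipschitz (f := fun x => a ** x) (normr_ge0 a)) => // x y.
by rewrite -mulcB ler_norm_cmul.
Qed.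

Lemma preim_star_subspace M :
  closed_linear_subspace M -> closed_linear_subspace [set x | M (star x)].
Proof.
move=> [[M0 sM] cM]; split.
  split=> [|k x y]; first by rewrite /= star0.
  by rewrite /= starD starZ; apply: sM.
apply: (closed_preim_lipschitz (f := star) ler01) => // x y.
by rewrite -starB norm_star mul1r.
Qed.

Lemma prod_subspace X Y : closed_linear_subspace (prod_closed_span X Y).
Proof. exact: closed_span_subspace. Qed.

Lemma mem_prod X Y x y : X x -> Y y -> prod_closed_span X Y (x ** y).
Proof. by move=> Xx Yy; apply: sub_closed_span; exists x => //; exists y. Qed.

Lemma prod_min X Y M : closed_linear_subspace M ->
  (forall x y, X x -> Y y -> M (x ** y)) -> prod_closed_span X Y `<=` M.
Proof.
by move=> cM H; apply: closed_span_min => // _ [x Xx [y Yy <-]]; apply: H.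
Qed.

Lemma prodS X X' Y Y' : X `<=` X' -> Y `<=` Y' ->
  prod_closed_span X Y `<=` prod_closed_span X' Y'.
Proof.
move=> XX' YY'; apply: prod_min; first exact: prod_subspace.
by move=> x y /XX' Xx /YY' Yy; apply: mem_prod.
Qed.

Lemma prodA X Y Z : prod_closed_span X (prod_closed_span Y Z) =
  prod_closed_span (prod_closed_span X Y) Z.
Proof.
apply/seteqP; split; apply: prod_min; try exact: prod_subspace.
  move=> x w Xx; move: w; apply: prod_min.
    by apply: preim_mull_subspace; apply: prod_subspace.
  by move=> y z Yy Zz /=; rewrite cmulA; apply: mem_prod => //; apply: mem_prod.
move=> w z + Zz; move: w; apply: prod_min.
  by apply: preim_mulr_subspace; apply: prod_subspace.
by move=> x y Xx Yy /=; rewrite -cmulA; apply: mem_prod => //; apply: mem_prod.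
Qed.

End Spans.

(** * Resolvents of self-adjoint elements *)

Section Resolvents.
Variables (R : realType) (B : cstarAlgType R).
Implicit Types (A : set B) (a b h u v x y : B) (c d e k : R[i]).

(** The equation of [h (h + c)^-1], which makes sense without a unit. *)
Definition resolvent_eq h c u := h ** u + c *: u = h.

(** With [w = 1 - u = c / (h + c)], the element [1 - x = (c / 2) / (h + c / 2)]
    equals [w / (2 - w)]; the hypothesis on [x] is this relation, written as a
    fixed point equation with ratio 1/2 as soon as [w] is a contraction. *)
Lemma resolvent_eq_half h c u x : resolvent_eq h c u ->
  u + 2^-1 *: (x - u ** x) = x -> resolvent_eq h (c / 2) x.
Proof.
rewrite /resolvent_eq => hu xE.
have n2 : (2 : R[i]) != 0 by rewrite pnatr_eq0.
have uxE : u ** x = 2 *: u - x.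
  have : 2 *: x = 2 *: u + (x - u ** x).
    by rewrite -[in LHS]xE scalerDr scalerA divff // scale1r.
  rewrite [2 *: x]scaler_nat mulr2n addrCA => /addrI {2}->.
  by rewrite opprB addrC subrK.
have : h ** (u ** x) + c *: (u ** x) = h ** x.
  by rewrite cmulA -cmulZl -cmulDl hu.
rewrite uxE mulcB cmulZr scalerBr scalerA [c * 2]mulrC -[(2 * c) *: _]scalerA.
rewrite addrACA -scalerDr hu => hxE.
apply: (scalerI n2); rewrite scalerDr scalerA mulrCA divff // mulr1.
rewrite -(subrK (h ** x + c *: x) (2 *: h)) opprD hxE.
by rewrite [2 *: _]scaler_nat mulr2n addrA.
Qed.

Lemma imaginary_param d :
  0 < d -> 'i * d != 0 /\ Num.conj ('i * d) = - ('i * d).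
Proof.
move=> d0; split; first by rewrite mulf_neq0 ?neq0Ci // gt_eqF.
by rewrite rmorphM /= conjCi conj_Creal ?gtr0_real // mulNr.
Qed.

Section ImaginaryParameter.
Variables (h u : B) (c : R[i]).
Hypotheses (sh : star h = h) (c0 : c != 0) (conj_c : Num.conj c = - c).
Hypothesis hu : resolvent_eq h c u.

Let star_hu : star u ** h - c *: star u = h.
Proof.
by rewrite -{2}sh -{2}hu starD starM starZ sh conj_c scaleNr.
Qed.

(* For self-adjoint [h], [x* h x] is self-adjoint, while [- c x* x] is
   skew-adjoint; so [h x = - c x] makes both vanish. *)
Let inj_hc x : h ** x + c *: x = 0 -> x = 0.
Proof.
move=> /eqP; rewrite addr_eq0 => /eqP hx.
have xhx : star x ** h ** x = - (c *: (star x ** x)).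
  by rewrite -cmulA hx -scaleNr cmulZr scaleNr.
have xhx' : star x ** h ** x = c *: (star x ** x).
  have := congr1 star xhx; rewrite !starM starK sh cmulA => ->.
  by rewrite -scaleNr starZ starM starK rmorphN /= conj_c opprK.
have : c *: (star x ** x) *+ 2 = 0 by rewrite mulr2n -{1}xhx' xhx addNr.
move=> /eqP; rewrite -scaler_nat scaler_eq0 pnatr_eq0 scaler_eq0 (negPf c0) /=.
move=> /eqP xx.
by apply/eqP; rewrite -normr_eq0 -sqrf_eq0 -norm_cstar xx normr0.
Qed.

Lemma resolvent_comm : h ** u = u ** h.
Proof.
apply/subr0_eq/inj_hc; rewrite mulcB scalerBr addrACA -opprD.
rewrite (cmulA h u h) -[c *: (u ** h)]cmulZl -cmulDl hu.
by rewrite -cmulZr -cmulDr hu subrr.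
Qed.

(* This says [(1 - 2 u)* (1 - 2 u) = 1]. *)
Let real_part : star u ** u + star u ** u = star u + u.
Proof.
have e1 : star u ** h ** u + c *: (star u ** u) = h + c *: star u.
  by rewrite -cmulA -cmulZr -cmulDr hu -[in RHS]star_hu subrK.
have e2 : star u ** h ** u - c *: (star u ** u) = h - c *: u.
  by rewrite -cmulZl -mulBc star_hu -{2}hu addrK.
have sub (p q r : B) : p + q - (p - r) = q + r.
  by rewrite opprB addrC subrKA addrC.
apply: (scalerI c0); rewrite !scalerDr.
by rewrite -(sub (star u ** h ** u)) e1 e2 sub.
Qed.

Let isometry x : `|x - (u ** x + u ** x)| = `|x|.
Proof.
apply/eqP; rewrite -(eqrXn2 (n := 2)) // -!norm_cstar; apply/eqP; congr `|_|.
set y := u ** x; set z := y + y.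
have yy : star y ** y + star y ** y = star y ** x + star x ** y.
  rewrite /y starM -!cmulA (cmulA (star u) u x) -!cmulDr -!cmulDl.
  by rewrite -real_part cmulDr cmulDl.
have -> : star (x - z) ** (x - z) =
    star x ** x - star x ** z - (star z ** x - star z ** z).
  by rewrite starB mulBc !mulcB.
have -> : star z ** z = star x ** z + star z ** x.
  by rewrite /z starD !cmulDl !cmulDr yy addrACA [RHS]addrC.
by rewrite opprB addrK subrK.
Qed.

Let half_norm x y : `|x| = `|y| -> `|2^-1 *: (x + y)| <= `|x|.
Proof.
move=> xy; rewrite normrZ normfV normr_nat mulrC ler_pdivrMr ?ltr0n //.
by rewrite (le_trans (ler_normD _ _)) // -xy mulr_natr mulr2n.
Qed.

Let half2 x : x = 2^-1 *: (x + x).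
Proof.
by rewrite -mulr2n -[x *+ 2]scaler_nat scalerA mulVf ?pnatr_eq0 // scale1r.
Qed.

Lemma resolvent_contraction x : `|x - u ** x| <= `|x|.
Proof.
have -> : x - u ** x = 2^-1 *: (x + (x - (u ** x + u ** x))).
  by rewrite [LHS]half2 addrACA opprD [in RHS]addrA.
exact: half_norm (esym (isometry x)).
Qed.

Lemma resolvent_norm_mul x : `|u ** x| <= `|x|.
Proof.
have e := isometry x; rewrite -normrN in e.
rewrite [u ** x]half2 -[in X in X <= _](subrK x (u ** x + u ** x)) addrC -opprB.
exact: half_norm (esym e).
Qed.

Lemma resolvent_norm : `|u| <= 1.
Proof.
have [->|u0] := eqVneq u 0; first by rewrite normr0 ler01.
rewrite -(@ler_pM2r _ `|u|) ?normr_gt0 // mul1r -expr2 -(norm_star u).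
by rewrite -norm_cstar starK resolvent_norm_mul.
Qed.

(** Writing [1] formally, [(1 - u) h = c u], so [(1 - u) a] has square norm
    [`|(1 - u) h (1 - u)*| = `|c| * `|u (1 - u)*|], and left
    multiplication by [u] or by [1 - u] is a contraction. *)
Lemma resolvent_residue a : h = a ** star a -> `|a - u ** a| ^+ 2 <= `|c|.
Proof.
move=> hE; set p := a - u ** a.
have pa : p ** star a = c *: u.
  by rewrite /p mulBc -cmulA -hE -resolvent_comm -{1}hu addrC addKr.
have -> : `|p| ^+ 2 = `|p ** star p|.
  by rewrite -{2}[p]starK norm_cstar norm_star.
rewrite {2}/p starB starM mulcB cmulA pa cmulZl -scalerBr normrZ.
rewrite -[leRHS]mulr1 ler_wpM2l // -norm_star starB starM starK.
by rewrite (le_trans (resolvent_contraction _)) // norm_star resolvent_norm.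
Qed.

End ImaginaryParameter.

(** The starting value of the parameter exceeds [2 `|h|] to make the Neumann
    iteration contract with ratio 1/2. *)
Lemma resolvent_eq_exists A h n : cstar_subalgebra A -> A h -> star h = h ->
  exists2 u, A u & resolvent_eq h ('i * ((`|h| * 2 + 1) / 2 ^+ n)) u.
Proof.
move=> [[sA cA] AM _] Ah sh.
have A0 : A !=set0 by exists h.
have h1 : 0 < `|h| * 2 + 1 by rewrite ltr_wpDl // mulr_ge0.
elim: n => [|n [u Au hu]].
  set c : R[i] := _ * _.
  have nc : `|c| = `|h| * 2 + 1.
    by rewrite /c expr0 divr1 normrM normCi mul1r gtr0_norm.
  have c0 : c != 0 by rewrite -normr_gt0 nc.
  have [||x Ax xE] := half_lipschitz_fixpoint
      (f := fun x => c^-1 *: (h - h ** x)) cA A0.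
  - by move=> x Ax; apply: subspaceZ => //; apply: subspaceB => //; apply: AM.
  - move=> x y; rewrite -scalerBr normrZ opprB addrC subrKA -mulcB normfV nc.
    rewrite ler_pdivrMl // (le_trans (ler_norm_cmul _ _)) // mulrA distrC.
    by rewrite ler_wpM2r // ler_pdivlMr ?ltr0n // lerDl.
  - exists x => //; rewrite /resolvent_eq -{2}xE scalerA divff // scale1r.
    by rewrite addrC subrK.
set d := _ / 2 ^+ n in hu.
have d0 : 0 < d by rewrite divr_gt0 // exprn_gt0 ?ltr0n.
have [c0 cc] := imaginary_param d0.
have [||x Ax xE] := half_lipschitz_fixpoint
    (f := fun x => u + 2^-1 *: (x - u ** x)) cA A0.
- move=> x Ax; apply: subspaceD => //; apply: subspaceZ => //.
  by apply: subspaceB => //; apply: AM.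
- move=> x y; rewrite opprD addrACA subrr add0r -scalerBr normrZ.
  rewrite normfV normr_nat ler_wpM2l ?invr_ge0 //.
  by rewrite opprD addrACA -opprD -mulcB (resolvent_contraction sh c0 cc hu).
- exists x => //; rewrite exprSr invfM !mulrA.
  by have := resolvent_eq_half hu xE; rewrite !mulrA.
Qed.

End Resolvents.

(** * Approximate units *)

Section ApproximateUnits.
Variables (R : realType) (B : cstarAlgType R).
Implicit Types (A M N : set B) (a b u v x y : B) (e k : R[i]).

Definition contractive_in A u := A u /\ forall x, `|x - u ** x| <= `|x|.

(** The expression of [u] as [k (h - h u)] is kept because it exhibits [u ** m]
    as an element of [h M] when [a = m] belongs to a slice [M]. *)
Lemma approx_unit_of_square A a e : cstar_subalgebra A -> A (a ** star a) ->
  0 < e -> exists u k, [/\ contractive_in A u,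
    u = k *: (a ** star a - a ** star a ** u) & `|a - u ** a| < e].
Proof.
move=> hA; set h := a ** star a => Ah e0.
have sh : star h = h by rewrite starM starK.
have h1 : 0 <= `|h| * 2 + 1 by rewrite addr_ge0 // mulr_ge0.
have [n nd] := geometric_half_lt h1 (exprn_gt0 2 e0).
have [u Au hu] := resolvent_eq_exists n hA Ah sh.
rewrite exprVn in nd; set d := _ / _ in nd hu.
have d0 : 0 < d by rewrite divr_gt0 ?exprn_gt0 ?ltr0n // ltr_wpDl // mulr_ge0.
have [c0 cc] := imaginary_param d0.
exists u, ('i * d)^-1; split.
- by split=> //; exact: resolvent_contraction hu.
- by rewrite -{1}hu addrAC subrr add0r scalerA mulVf // scale1r.
- rewrite -(ltr_pXn2r (n := 2)) ?nnegrE ?(ltW e0) //.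
  apply: le_lt_trans (resolvent_residue sh c0 cc hu erefl) _.
  by rewrite normrM normCi mul1r gtr0_norm.
Qed.

Lemma contractive_in0 A : cstar_subalgebra A -> contractive_in A 0.
Proof. by case=> [[[A0 _] _] _ _]; split=> // x; rewrite mul0c subr0. Qed.

(** [1 - (u + v - v u) = (1 - v) (1 - u)]: composing contractions makes several
    elements small at once, which replaces an order on approximate units. *)
Lemma circle_defect u v x :
  x - (u + v - v ** u) ** x = (x - u ** x) - v ** (x - u ** x).
Proof. by rewrite mulBc cmulDl mulcB cmulA -addrA opprD addrA. Qed.

Lemma contractive_in_circle A u v : cstar_subalgebra A ->
  contractive_in A u -> contractive_in A v -> contractive_in A (u + v - v ** u).
Proof.
move=> [[sA _] AM _] [Au cu] [Av cv]; split.
  by apply: subspaceB => //; [exact: subspaceD | exact: AM].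
by move=> x; rewrite circle_defect (le_trans (cv _)).
Qed.

Lemma approx_unit A b e : cstar_subalgebra A -> prod_closed_span A setT b ->
  0 < e -> exists2 u, contractive_in A u & `|b - u ** b| < e.
Proof.
move=> hA Ab e0.
(* Asking that every earlier [u] can be improved makes [P] additive: after
   treating the first summand with [v], apply [P] to the second one with
   [(1 - v) (1 - u)] in place of [1 - u]. *)
pose P b := forall u, contractive_in A u -> forall e, 0 < e ->
  exists2 v, contractive_in A v & `|b - u ** b - v ** (b - u ** b)| < e.
suff /(_ b Ab)/(_ _ (contractive_in0 hA) _ e0)[v cv] :
    prod_closed_span A setT `<=` P.
  by rewrite mul0c subr0; exists v.
apply: prod_min; last first.
  move=> a x Aa _ u cu {e0}e e0; set a' := a - u ** a.
  have Aa' : A a'.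
    by case: hA cu => [[sA _] AM _] [Au _]; apply: subspaceB => //; apply: AM.
  have Aaa : A (a' ** star a').
    by case: hA => _ AM As; apply: AM => //; apply: As.
  have x0 : 0 < `|x| + 1 by rewrite ltr_wpDl.
  have [v [k [cv _ va]]] := approx_unit_of_square hA Aaa (divr_gt0 e0 x0).
  exists v => //; rewrite cmulA -mulBc cmulA -mulBc -/a'.
  apply: le_lt_trans (ler_norm_cmul _ _) _.
  move: va; rewrite ltr_pdivlMr //; apply: le_lt_trans.
  by rewrite ler_wpM2l // lerDl.
split; [split|].
- move=> u cu {e0}e e0; exists 0; first exact: contractive_in0.
  by rewrite !(mulc0, mul0c, subr0) normr0.
- move=> k x y Px Py u cu {e0}e e0.
  have k1 : 0 < `|k| + 1 by rewrite ltr_wpDl.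
  have e2 : 0 < e / 2 by rewrite divr_gt0 ?ltr0n.
  have [v cv vx] := Px _ cu _ (divr_gt0 e2 k1).
  have [w cw wy] := Py _ (contractive_in_circle hA cu cv) _ e2.
  exists (v + w - w ** v); first exact: contractive_in_circle.
  rewrite circle_defect in wy; rewrite circle_defect.
  have defectD z s t : k *: s + t - z ** (k *: s + t) =
      k *: (s - z ** s) + (t - z ** t).
    by rewrite cmulDr cmulZr opprD addrACA -scalerBr.
  rewrite !defectD [e]splitr (le_lt_trans (ler_normD _ _)) //.
  rewrite ltr_leD ?(ltW wy) // normrZ.
  apply: (@le_lt_trans _ _ ((`|k| + 1) * `|x - u ** x - v ** (x - u ** x)|)).
    by rewrite ler_pM // ?lerDl //; case: cw => _; apply.
  by rewrite mulrC -ltr_pdivlMr.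
- move=> x Px u cu {e0}e e0.
  have e2 : 0 < e / 2 by rewrite divr_gt0 ?ltr0n.
  have [y Py xy] := closure_dist Px e2.
  have [v cv vy] := Py _ cu _ e2.
  exists v => //; rewrite -circle_defect in vy; rewrite -circle_defect.
  have [_ cw] := contractive_in_circle hA cu cv.
  set w := u + v - v ** u in vy cw *.
  have -> : x - w ** x = (x - y - w ** (x - y)) + (y - w ** y).
    by rewrite mulcB opprD [x - y + _]addrACA -opprD subrK.
  rewrite [e]splitr (le_lt_trans (ler_normD _ _)) // ltrD //.
  exact: le_lt_trans (cw _) xy.
Qed.

End ApproximateUnits.

(** * Generalised inverses when idempotents commute *)

Section InverseSemigroups.
Variables (T : Type) (S : set T) (op : T -> T -> T).
Hypothesis opS : forall s t, S s -> S t -> S (op s t).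
Hypothesis opA : forall s t u, op s (op t u) = op (op s t) u.
Hypothesis idem_comm : forall e f, S e -> S f -> op e e = e -> op f f = f ->
  op e f = op f e.

(** Both inverses equal [x s y]: commute the idempotents [s x], [s y] in
    [x (s y s) x], and [x s], [y s] in [y (s x s) y]. *)
Lemma generalised_inverse_unique s x y : S s -> S x -> S y ->
  op (op s x) s = s -> op (op x s) x = x ->
  op (op s y) s = s -> op (op y s) y = y -> x = y.
Proof.
move=> Ss Sx Sy sxs xsx sys ysy.
have idl t : op (op s t) s = s -> op (op s t) (op s t) = op s t.
  by move=> sts; rewrite opA sts.
have idr t : op (op s t) s = s -> op (op t s) (op t s) = op t s.
  by move=> sts; rewrite -opA (opA s) sts.
have xE : op x (op s y) = x.
  have comm := idem_comm (opS Ss Sx) (opS Ss Sy) (idl _ sxs) (idl _ sys).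
  have := congr1 (op x) comm.
  rewrite (opA x (op s x)) (opA x s x) xsx => ->.
  by rewrite (opA (op s y)) sys (opA x s x) xsx.
have yE : op (op x s) y = y.
  have comm := idem_comm (opS Sx Ss) (opS Sy Ss) (idr _ sxs) (idr _ sys).
  have := congr1 (op^~ y) comm.
  by rewrite -(opA (op x s)) ysy => ->; rewrite -(opA y) (opA s) sxs ysy.
by rewrite -xE opA yE.
Qed.

End InverseSemigroups.

(** * The inverse semigroup of slices *)

Section Slices.
Variables (R : realType) (B : cstarAlgType R) (A : set B).
Hypotheses (hA : cstar_subalgebra A) (ndA : nondegenerate_incl A).
Implicit Types (M N E I J K : set B) (a b x y m n : B) (e k : R[i]).

Local Notation "M ∙ N" := (prod_closed_span M N)
  (at level 40, left associativity).

Let clsA : closed_linear_subspace A. Proof. by case: hA. Qed.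
Let subA : linear_subspace A. Proof. by case: clsA. Qed.
Let mulA a b : A a -> A b -> A (a ** b).
Proof. by case: hA => _ AM _; apply: AM. Qed.
Let starA a : A a -> A (star a).
Proof. by case: hA => _ _; apply. Qed.

(** This is the form in which approximate units are used: [x] is a limit of
    elements [u ** x]. *)
Lemma mem_of_left_multiples M x :
  closed M -> (forall a, A a -> M (a ** x)) -> M x.
Proof.
move=> cM Mx; apply: closed_dist => // e e0.
have Bx : prod_closed_span A setT x by rewrite ndA.
have [u [Au _] xu] := approx_unit hA Bx e0.
by exists (u ** x) => //; apply: Mx.
Qed.

Lemma mem_of_right_multiples M x :
  closed M -> (forall a, A a -> M (x ** a)) -> M x.
Proof.
move=> cM Mx; rewrite -[x]starK.
apply: (@mem_of_left_multiples [set y | M (star y)]).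
  apply: (closed_preim_lipschitz (f := star) ler01) => // y z.
  by rewrite -starB norm_star mul1r.
by move=> a Aa; rewrite /= starM starK; apply/Mx/starA.
Qed.

Lemma star_setE M : star_set M = [set x | M (star x)].
Proof.
apply/seteqP; split=> [_ [x Mx <-]|x Mx]; first by rewrite /= starK.
by exists (star x) => //; rewrite starK.
Qed.

Lemma star_setK M : star_set (star_set M) = M.
Proof. by rewrite !star_setE; apply/seteqP; split => x /=; rewrite starK. Qed.

Lemma star_slice M : slices A M -> slices A (star_set M).
Proof.
case=> MN clsM AM MA; rewrite star_setE; split.
- move=> x /MN[N1 N2]; split=> a Aa.
    by have := N2 _ Aa; rewrite starK.
  by have := N1 _ Aa; rewrite starK.
- exact: preim_star_subspace.
- by move=> a m Aa /= Mm; rewrite starM; apply: MA => //; apply: starA.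
- by move=> a m Aa /= Mm; rewrite starM; apply: AM => //; apply: starA.
Qed.

(** Polarisation: membership in [M] gives only the diagonal values of the
    sesquilinear form [(x, y) |-> x* a y]; apply it to [x + y] and [x + i y]. *)
Lemma slice_star_mid M a x y : slices A M -> A a -> M x -> M y ->
  A (star x ** a ** y).
Proof.
case=> MN [sM _] _ _ Aa.
have sym s t : M s -> M t -> A (star s ** a ** t + star t ** a ** s).
  move=> Ms Mt.
  have [_ /(_ a Aa) As] := MN _ Ms; have [_ /(_ a Aa) At] := MN _ Mt.
  have [_ /(_ a Aa)] := MN _ (subspaceD sM Ms Mt).
  rewrite starD cmulDl !cmulDr !cmulDl addrACA => Ast.
  have -> : star s ** a ** t + star t ** a ** s =
      star s ** a ** s + star s ** a ** t
        + (star t ** a ** s + star t ** a ** t)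
        - star s ** a ** s - star t ** a ** t.
    rewrite [X in _ = X - _]addrC -[star s ** a ** s + _ + _]addrA addKr.
    by rewrite addrA addrK.
  by do 2![apply: subspaceB => //].
move=> Mx My; have n2 : (2 : R[i]) != 0 by rewrite pnatr_eq0.
have Miy : M ('i *: y) by apply: subspaceZ.
have sum := sym _ _ Mx My.
have diff : A (star x ** a ** y - star y ** a ** x).
  have := subspaceZ (- 'i) subA (sym _ _ Mx Miy).
  rewrite starZ conjCi cmulZr !cmulZl scalerDr !scalerA mulNr mulrNN -expr2.
  by rewrite sqrCi opprK scale1r scaleN1r.
have := subspaceZ 2^-1 subA (subspaceD subA sum diff).
rewrite addrACA subrr addr0 -mulr2n -[star x ** a ** y *+ 2]scaler_nat.
by rewrite scalerA mulVf // scale1r.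
Qed.

Lemma slice_mid_star M a x y : slices A M -> A a -> M x -> M y ->
  A (x ** a ** star y).
Proof.
move=> sM Aa Mx My; rewrite -[x]starK.
by apply: (slice_star_mid (star_slice sM)) => //; [exists x | exists y].
Qed.

Lemma slice_star_mul M x y : slices A M -> M x -> M y -> A (star x ** y).
Proof.
move=> sM Mx My.
apply: (@mem_of_left_multiples [set z | A (star x ** z)]).
  by have [] := preim_mull_subspace (star x) clsA.
by move=> a Aa; rewrite /= cmulA; apply: slice_star_mid My.
Qed.

Lemma slice_mul_star M x y : slices A M -> M x -> M y -> A (x ** star y).
Proof.
move=> sM Mx My; rewrite -[x]starK.
by apply: (slice_star_mul (star_slice sM)); [exists x | exists y].
Qed.

Lemma slice_cls M : slices A M -> closed_linear_subspace M.
Proof. by case. Qed.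

Lemma slice_unit : slices A A.
Proof.
split=> //; last by move=> a m Aa Am; apply: mulA.
by move=> b Ab; split=> a Aa; do ![apply: mulA | apply: starA | done].
Qed.

(** The set of normalisers is not a linear space; a closed span stays inside it
    when the off-diagonal products of its generators also land in [A]. *)
Lemma closed_span_normalisers X :
  (forall a x y, A a -> X x -> X y -> A (x ** a ** star y)) ->
  (forall a x y, A a -> X x -> X y -> A (star x ** a ** y)) ->
  closed_span X `<=` normalisers A.
Proof.
move=> X1 X2 w Xw; split=> a Aa.
  suff : closed_span X `<=` [set v | A (v ** a ** star w)] by apply.
  apply: closed_span_min.
    by have := preim_mulr_subspace a (preim_mulr_subspace (star w) clsA).
  move=> x Xx /=; move: w Xw; apply: closed_span_min.
    by have := preim_star_subspace (preim_mull_subspace (x ** a) clsA).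
  by move=> y Xy; apply: X1.
suff : closed_span X `<=` [set v | A (star v ** a ** w)] by apply.
apply: closed_span_min.
  have := preim_mulr_subspace a (preim_mulr_subspace w clsA).
  by move=> /preim_star_subspace.
move=> x Xx /=; move: w Xw; apply: closed_span_min.
  by have := preim_mull_subspace (star x ** a) clsA.
by move=> y Xy; apply: X2.
Qed.

Lemma prod_slice M N : slices A M -> slices A N -> slices A (M ∙ N).
Proof.
move=> sM sN; have [_ clsM AM _] := sM; have [_ clsN _ NA] := sN.
split; last 3 first.
- exact: prod_subspace.
- move=> a w Aa; move: w; apply: prod_min.
    by apply: preim_mull_subspace; apply: prod_subspace.
  by move=> m n Mm Nn; rewrite /= cmulA; apply: mem_prod => //; apply: AM.
- move=> a w Aa; move: w; apply: prod_min.
    by apply: preim_mulr_subspace; apply: prod_subspace.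
  by move=> m n Mm Nn; rewrite /= -cmulA; apply: mem_prod => //; apply: NA.
apply: closed_span_normalisers => a _ _ Aa
    [m Mm [n Nn <-]] [m' Mm' [n' Nn' <-]].
  rewrite starM cmulA -2!(cmulA m).
  by apply: slice_mid_star Mm' => //; apply: slice_mid_star Nn'.
rewrite starM cmulA -2!(cmulA (star n)).
by apply: slice_star_mid Nn' => //; apply: slice_star_mid Mm'.
Qed.

Lemma prod_unitl M : slices A M -> A ∙ M = M.
Proof.
case=> _ clsM AM _; apply/seteqP; split; first exact: prod_min.
move=> m Mm; apply: mem_of_left_multiples; first by case: (prod_subspace A M).
by move=> a Aa; apply: mem_prod.
Qed.

Lemma prod_unitr M : slices A M -> M ∙ A = M.
Proof.
case=> _ clsM _ MA; apply/seteqP; split.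
  by apply: prod_min => // m a Mm Aa; apply: MA.
move=> m Mm; apply: mem_of_right_multiples; first by case: (prod_subspace M A).
by move=> a Aa; apply: mem_prod.
Qed.

(** For [m] in [M], a resolvent for [h = m m*] gives
    [u m = k (h - h u) m = k m m* (m - u m)], an element of [M M* M] close to
    [m]. *)
Lemma prod_starK M : slices A M -> M ∙ star_set M ∙ M = M.
Proof.
move=> sM; have [_ clsM AM _] := sM; apply/seteqP; split.
  apply: prod_min => // w m MMw Mm; apply: AM Mm; move: w MMw.
  apply: prod_min => //.
  by move=> x _ Mx [y My <-]; apply: slice_mul_star My.
move=> m Mm; have [sP clP] := prod_subspace (M ∙ star_set M) M.
apply: closed_dist => // e e0.
have Amm : A (m ** star m) by exact: (slice_mul_star sM).
have [u [k [[Au _] uE mu]]] := approx_unit_of_square hA Amm e0.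
exists (u ** m) => //; rewrite uE cmulZl mulBc -[_ ** u ** m]cmulA -mulcB.
apply: (subspaceZ _ sP).
apply: mem_prod; first by apply: mem_prod => //; exists m.
by case: clsM => sM' _; apply: subspaceB => //; apply: AM.
Qed.

(** [K = I J] lies in [I] and in [J], so [K = K (K* K)] lies in [J I]. *)
Lemma prod_subA_sub I J : slices A I -> slices A J -> I `<=` A -> J `<=` A ->
  I ∙ J `<=` J ∙ I.
Proof.
move=> sI sJ IA JA; have sK := prod_slice sI sJ.
have [_ clsI _ I_A] := sI; have [_ clsJ A_J _] := sJ.
have KI : I ∙ J `<=` I by apply: prod_min => // x y Ix /JA Ay; apply: I_A.
have KJ : I ∙ J `<=` J by apply: prod_min => // x y /IA Ax; apply: A_J.
rewrite -{1}(prod_starK sK) -prodA; apply: prodS => //.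
apply: prod_min => // _ y [x /KI/IA Ax <-] /KI Iy.
by case: sI => _ _ A_I _; apply: A_I => //; apply: starA.
Qed.

Lemma prod_subA_comm I J : slices A I -> slices A J -> I `<=` A -> J `<=` A ->
  I ∙ J = J ∙ I.
Proof. by move=> *; apply/seteqP; split; apply: prod_subA_sub. Qed.

(** The range [K = E E*] and the source [J = E* E] of an idempotent [E] are
    ideals of [A] with [E K = K] and [J E = J].  As ideals commute, these two
    absorption rules force [K = K J = J], and then [E = K E = J E = J]. *)
Lemma idempotent_slice_subA E : slices A E -> E ∙ E = E -> E `<=` A.
Proof.
move=> sE EE; have sE' := star_slice sE.
pose J := star_set E ∙ E; pose K := E ∙ star_set E.
have JA : J `<=` A.
  by apply: prod_min => // _ y [x Ex <-]; apply: slice_star_mul.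
have KA : K `<=` A.
  by apply: prod_min => // x _ Ex [y Ey <-]; apply: slice_mul_star Ey.
have KE : K ∙ E = E by apply: prod_starK.
have EJ : E ∙ J = E by rewrite prodA prod_starK.
have JE : J ∙ E = J by rewrite /J -prodA EE.
have EK : E ∙ K = K by rewrite /K prodA EE.
have JK : K ∙ J = J ∙ K by apply: prod_subA_comm => //; apply: prod_slice.
have KJ_K : K ∙ J = K by rewrite -{1}EK -(prodA E K J) JK (prodA E J K) EJ EK.
have KJ_J : K ∙ J = J.
  by rewrite -[RHS]JE -[X in _ = J ∙ X]KE (prodA J K E) -JK -(prodA K J E) JE.
have -> : E = J by rewrite -KE -KJ_K KJ_J JE.
exact: JA.
Qed.

Lemma slices_inverse_semigroup :
  inverse_semigroup (slices A) prod_closed_span star_set.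
Proof.
split.
- exact: prod_slice.
- exact: star_slice.
- by move=> *; apply: prodA.
- exact: prod_starK.
- by move=> M sM; have := prod_starK (star_slice sM); rewrite star_setK.
- move=> M N sM sN MNM NMN; have sM' := star_slice sM.
  apply: (generalised_inverse_unique prod_slice (@prodA _ _) _ sM) => //.
  + move=> I J sI sJ II JJ.
    by apply: prod_subA_comm => //; apply: idempotent_slice_subA.
  + exact: prod_starK.
  + by have := prod_starK sM'; rewrite star_setK.
Qed.

Lemma closed_sum_slices_subalgebra :
  cstar_subalgebra (closed_sum (slices A) id).
Proof.
have clsD : closed_linear_subspace (closed_sum (slices A) id).
  exact: closed_span_subspace.
split=> // [x y Dx Dy|].
  move: y Dy; apply: closed_span_min; first exact: preim_mull_subspace.
  move=> y [N sN Ny] /=; move: x Dx; apply: closed_span_min.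
    exact: preim_mulr_subspace.
  move=> x [M sM Mx] /=; apply: sub_closed_span.
  by exists (M ∙ N); [exact: prod_slice | exact: mem_prod].
apply: closed_span_min; first exact: preim_star_subspace.
move=> x [M sM Mx] /=; apply: sub_closed_span.
by exists (star_set M); [exact: star_slice | exists x].
Qed.

Lemma slices_grading :
  grading (slices A) prod_closed_span star_set id (closed_sum (slices A) id).
Proof.
split=> //.
- by move=> M; apply: slice_cls.
- by move=> M sM x Mx; apply: sub_closed_span; exists M.
- by move=> M N x y _ _; apply: mem_prod.
- move=> M N _ sN [E [sE EE ->]]; have [_ clsN _ NA] := sN.
  by apply: prod_min => // n x Nn /(idempotent_slice_subA sE EE) Ax; apply: NA.
Qed.

(** The slice is the closed span of [A b A]; it contains [b] by approximate
    units on both sides. *)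
Lemma normaliser_slice b : normalises b A -> exists2 M, slices A M & M b.
Proof.
move=> [N1 N2].
pose X := [set x | exists a a', [/\ A a, A a' & x = a ** b ** a']].
have clsX := closed_span_subspace X.
exists (closed_span X); last first.
  apply: mem_of_left_multiples => [|a Aa]; first by case: clsX.
  apply: mem_of_right_multiples => [|a' Aa']; first by case: clsX.
  by apply: sub_closed_span; exists a, a'.
split=> //; last 2 first.
- move=> c w Ac; move: w.
  apply: closed_span_min; first exact: preim_mull_subspace.
  move=> _ [a [a' [Aa Aa' ->]]] /=; apply: sub_closed_span.
  by exists (c ** a), a'; split => //; [apply: mulA | rewrite !cmulA].
- move=> c w Ac; move: w.
  apply: closed_span_min; first exact: preim_mulr_subspace.
  move=> _ [a [a' [Aa Aa' ->]]] /=; apply: sub_closed_span.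
  by exists a, (a' ** c); split => //; [apply: mulA | rewrite !cmulA].
apply: closed_span_normalisers => c _ _ Ac
    [a [a' [Aa Aa' ->]]] [d [d' [Ad Ad' ->]]].
  have := N1 _ (mulA (mulA Aa' Ac) (starA Ad')).
  by move=> /(mulA Aa) /mulA /(_ (starA Ad)); rewrite !starM !cmulA.
have := N2 _ (mulA (mulA (starA Aa) Ac) Ad).
by move=> /(mulA (starA Aa')) /mulA /(_ Ad'); rewrite !starM !cmulA.
Qed.

Lemma regular_iff_closed_sum_slices :
  regular_incl A <-> setT = closed_sum (slices A) id.
Proof.
split=> [[_ gen]|sum].
  apply/seteqP; split=> //; rewrite -gen; apply: smallest_sub.
    exact: closed_sum_slices_subalgebra.
  move=> b /normaliser_slice[M sM Mb]; apply: sub_closed_span.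
  by exists M.
split=> //; apply/seteqP; split=> // x _ D [[clsD _ _] ND].
have : closed_sum (slices A) id x by rewrite -sum.
move: x; apply: closed_span_min => // x [M [MN _ _ _] Mx].
exact/ND/MN.
Qed.

End Slices.

Theorem proposition6p26 (R : realType) (B : cstarAlgType R) (A : set B) :
  cstar_subalgebra A ->
  nondegenerate_incl A ->
  [/\ inverse_semigroup (slices A) prod_closed_span star_set,
      semigroup_unit (slices A) prod_closed_span A,
      cstar_subalgebra (closed_sum (slices A) id),
      grading (slices A) prod_closed_span star_set id
        (closed_sum (slices A) id) /\
      saturated (slices A) prod_closed_span id
    & regular_incl A <-> setT = closed_sum (slices A) id].
Proof.
move=> hA ndA; split.
- exact: slices_inverse_semigroup.
- split; first exact: slice_unit.
  by move=> M sM; split; [exact: prod_unitl | exact: prod_unitr].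
- exact: closed_sum_slices_subalgebra.
- by split; first exact: slices_grading.
- exact: regular_iff_closed_sum_slices.
Qed.
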